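(* Let $L\subseteq\mathbb R^n$ be a convex body and $K\in\mathscr K(\mathbb R^n)$ with $K\subseteq L$. Assume that $K$ is $(c_K,\theta_K)$-thick. Let $\mu=(\mu_j)_{j\ge1}$ be an admissible weight satisfying $\mu_j\ge j$ for $j\ge1$. Let $M_0>b_0>0$ and $m\in\mathbb N_{\ge1}$. Assume that $(\mu,mM_0,a_K,b_0)$ is admissible and let $\mathbf N=\mathbf N(\mu,mM_0,a_K,b_0)$. Let $f:L\to\mathbb R^m$ be a $(\mu^{|\mathbf N},M_0)$-smooth map satisfying $\|f\|_K\ge b_0$. For any function $g:K\to[-1,1]$ we have $$\|f\|_{B(x,\frac{|g(x)|}2)\cap K}\ge\frac{\|f\|_K}{\mathbf C_{\mathbf N}}\Big(\frac{c_K\,\nu_K}{m\,2^{\theta_K}|K|}\Big)^{\mathbf N}|g(x)|^{\theta_K\mathbf N}\qquad\text{for all }x\in K.$$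
   Context: $|E|$ denotes Lebesgue measure. A convex body is a compact convex set with nonempty interior. $B(x,r)$ is the closed ball of radius $r\ge0$ ($B(x,0)=\{x\}$). A nonempty measurable set $K\subseteq\mathbb R^n$ is $(c_K,\theta_K)$-thick, where $c_K,\theta_K>0$, if $|K\cap B(x,r)|\ge c_K r^{\theta_K}$ for all $x\in K$ and $0<r\le1$. Weights and smoothness. An admissible weight is a sequence $\mu=(\mu_j)_{j\ge1}$ of reals with $0<\mu_1\le\mu_2\le\cdots$. Given $M_0>0$ put $M_j=M_0\mu_1\cdots\mu_j$, $j\ge1$. For $N\in\mathbb N_{\ge1}\cup\{\infty\}$ and nonempty compact $L\subseteq\mathbb R^n$, a map $f=(f_1,\dots,f_m):L\to\mathbb R^m$ is $(\mu^{|N},M_0)$-smooth if it is of class $C^N$ in some open neighborhood of $L$ and $\sup_{x\in L}\sum_{i=1}^m\sum_{|\alpha|=j}\frac{j!}{\alpha!}|\partial^\alpha f_i(x)|\le M_j$ for all integers $0\le j<N+1$. Also $\|f\|_E:=\sup_{x\in E}\sum_{i=1}^m|f_i(x)|$. Degree. For $A,a,b>0$ let $j_0$ be the smallest nonnegative integer $\ge\log(A/b)$. The tuple $(\mu,A,a,b)$ is admissible if $\sum_{j=j_0+1}^\infty 1/\mu_j>a\,e$; then $\mathbf N(\mu,A,a,b):=2\sup\{k\in\mathbb N:\sum_{j=j_0+1}^k\frac1{a\mu_j}<e\}$ (empty sums are $0$). The constant $\mathbf C_{\mathbf N}$. Fix an increasing continuous, (piecewise) $C^1$ function $\tilde\mu:[1,\infty)\to(0,\infty)$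 with $\tilde\mu(j)=\mu_j$ for integers $j\ge1$ (left derivatives are used at points of nondifferentiability), put $\gamma_{\tilde\mu}(k):=\sup_{1\le s\le k}\frac{s\tilde\mu'(s)}{\tilde\mu(s)}$, and $\mathbf C_{\mathbf N}:=(4e^{4+\gamma_{\tilde\mu}(\mathbf N)})^{\mathbf N}$. Admissible sets. A family $(K_w,a_w,\Upsilon_w)_{w\in W}$, where $W$ is any set, $K_w\subseteq[0,1]^n$ is compact, $a_w\in K_w$, and $\Upsilon_w:[0,\infty)^n\to\mathbb R^n$ is a map, is an admissible collection of degree $d\in\mathbb N_{\ge1}$ if there are constants $\delta_1,\delta_2,\delta_3>0$, $q\in\mathbb N_{\ge1}$ and polynomial maps $R_w:\mathbb R^n\to\mathbb R^n$ of degree at most $d$ such that for all $w\in W$: (1) $K_w$ is star-shaped with respect to $a_w$ and $|K_w|\ge\delta_1$; (2) $\Upsilon_w(x_1,\dots,x_n)=R_w(x_1^{1/q},\dots,x_n^{1/q})$; (3) $\delta_2\le\sum_\kappa|c_{w,\kappa}|\le\delta_3$, where $c_{w,\kappa}$ are the coefficients of the polynomial $\operatorname{Jac}(R_w)$ (the Jacobian determinant); (4) writing $a_w=(a_{w,1},\dots,a_{w,n})$, $a_{w,i}=0$ whenever $\Upsilon_w$ is not a polynomial map with respect to the variable $x_i$. A nonempty compact set $K\subseteq\mathbb R^n$ is admissible (of degree $d$) if there is an admissible collection (of degree $d$) $(K_w,a_w,\Upsilon_w)_{w\in K}$ indexed by $K$ with $\Upsilon_w(a_w)=w$ for each $w\in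 K$ and $K=\bigcup_{w\in K}\Upsilon_w(K_w)$. $\mathscr K(\mathbb R^n)$ is the family of all admissible sets. For each $K\in\mathscr K(\mathbb R^n)$ such a collection and its degree $d$ are fixed ($d=1$ if $K$ is a convex body), and $$a_K:=4\,\tfrac{(d+1)^{d+1}}{(d-1)^{d-1}}\max\{\operatorname{diam}(K),1\}\ \text{ if }d\ge2,\qquad a_K:=\operatorname{diam}(K)\ \text{ if }d=1.$$ The constant $\nu_K$. For $K\in\mathscr K(\mathbb R^n)$, $\nu_K\in(0,1]$ denotes a fixed constant depending only on $K$ (with $\nu_K=1/n$ if $K$ is a convex body) for which the paper's Remez inequality holds: for every convex body $L\supseteq K$, every admissible weight $\mu$ with $\mu_j\ge j$, all $M_0>b_0>0$ and $m\ge1$ with $(\mu,mM_0,a_K,b_0)$ admissible and $\mathbf N'=\mathbf N(\mu,mM_0,a_K,b_0)$, every $(\mu^{|\mathbf N'},M_0)$-smooth $f:L\to\mathbb R^m$ with $\|f\|_K\ge b_0$, and every measurable $E\subseteq K$ with $|E|>0$, $\|f\|_K\le\mathbf C_{\mathbf N'}\big(\frac{m|K|^{\nu_K}}{|K|^{\nu_K}-(|K|-|E|)^{\nu_K}}\big)^{\mathbf N'}\|f\|_E$. (Such a constant exists for every $K\in\mathscr K(\mathbb R^n)$.) *)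

(* Defs.v *)
From HB Require Import structures.
From mathcomp Require Import all_boot all_order all_algebra.
From mathcomp Require Import all_classical all_reals all_analysis.
(* The notations of mpoly clash with those of analysis. *)
From mathcomp Require Import -(notations) mpoly.
Import Order.TTheory GRing.Theory Num.Theory.
Import numFieldNormedType.Exports.

Set Implicit Arguments.
Unset Strict Implicit.
Unset Printing Implicit Defensive.

Local Open Scope classical_set_scope.
Local Open Scope ring_scope.

Section Euclidean.
Context {R : realType} {n : nat}.
Local Notation V := 'rV[R]_n.
Implicit Types (x y a b : V) (A K : set V).

(* The norm carried by 'rV[R]_n in the library is the sup norm; balls and
   diameters are taken with respect to the Euclidean norm. *)
Definition enorm x : R := Num.sqrt (\sum_(i < n) x ord0 i ^+ 2).

Definition eball x (r : R) : set V := [set y | enorm (y - x) <= r].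

Definition diam K : R := sup [set enorm (x - y) | x in K & y in K].

Definition box a b : set V :=
  [set x | forall i, a ord0 i <= x ord0 i <= b ord0 i].

Definition box_vol a b : R := \prod_(i < n) (b ord0 i - a ord0 i).

(* Lebesgue outer measure: infimum of the total volumes of the countable covers
   by closed boxes, possibly flat. *)
Definition lebesgue_outer A : \bar R :=
  ereal_inf [set v | exists a b : nat -> V,
    [/\ forall k i, (a k ord0 i <= b k ord0 i)%R,
        A `<=` \bigcup_k box (a k) (b k)
      & v = \sum_(0 <= k <oo) (box_vol (a k) (b k))%:E]%E].

Definition lebesgue_measurable A : Prop := caratheodory_measurable lebesgue_outer A.

Definition vol A : R := fine (lebesgue_outer A).

Definition convex_body K : Prop :=
  [/\ compact K, convex_set K & K° !=set0].

Definition thick (c theta : R) K : Prop :=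
  [/\ K !=set0, lebesgue_measurable K, 0 < c, 0 < theta &
      forall x r, K x -> 0 < r <= 1 ->
        ((c * r `^ theta)%:E <= lebesgue_outer (K `&` eball x r))%E].

Definition star_shaped a K : Prop :=
  forall x (t : R), K x -> 0 <= t <= 1 -> K ((1 - t) *: a + t *: x).

End Euclidean.

Section Smoothness.
Context {R : realType} {n : nat}.
Local Notation V := 'rV[R]_n.

Definition partial (i : 'I_n) (g : V -> R) : V -> R :=
  fun x => 'D_(delta_mx ord0 i) g x.

Fixpoint class_C (N : nat) (U : set V) (g : V -> R) : Prop :=
  (forall x, U x -> {for x, continuous g}) /\
  if N is N'.+1 then
    forall i, (forall x, U x -> derivable g x (delta_mx ord0 i)) /\
              class_C N' U (partial i g)
  else True.

Definition mpartial (alpha : 'I_n -> nat) (g : V -> R) : V -> R :=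
  foldr (fun i => iter (alpha i) (partial i)) g (enum 'I_n).

(* The j-th order sum over |alpha| = j; every entry of such a multi-index
   is at most j. *)
Definition jet_sum (j : nat) (g : V -> R) (x : V) : R :=
  \sum_(alpha : {ffun 'I_n -> 'I_j.+1} | (\sum_(i < n) alpha i)%N == j)
    (j`!)%:R / (\prod_(i < n) (alpha i)`!)%N%:R *
    `|mpartial (fun i => alpha i) g x|.

Definition admissible_weight (mu : nat -> R) : Prop :=
  0 < mu 1%N /\ forall j, (1 <= j)%N -> mu j <= mu j.+1.

Definition weight_M (mu : nat -> R) (M0 : R) (j : nat) : R :=
  M0 * \prod_(1 <= i < j.+1) mu i.

(* The map is represented by a total function; only its restriction to L
   (extended to a neighbourhood of L) matters. *)
Definition smooth (m : nat) (mu : nat -> R) (N : nat) (M0 : R) (L : set V)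
    (f : V -> 'rV[R]_m) : Prop :=
  (exists U : set V, [/\ open U, L `<=` U &
     forall i, class_C N U (fun x => f x ord0 i)]) /\
  forall j, (j <= N)%N -> forall x, L x ->
    \sum_(i < m) jet_sum j (fun y => f y ord0 i) x <= weight_M mu M0 j.

Definition norm_on (m : nat) (f : V -> 'rV[R]_m) (E : set V) : R :=
  sup [set \sum_(i < m) `|f x ord0 i| | x in E].

End Smoothness.

Section Degree.
Context {R : realType}.
Implicit Types (mu : nat -> R) (A a b : R).

Definition start_index A b : nat := absz (Num.max 0 (Num.ceil (ln (A / b))))%R.

Definition admissible_tuple mu A a b : Prop :=
  [/\ 0 < A, 0 < a, 0 < b &
      ((a * expR 1)%:E < \sum_((start_index A b).+1 <= j <oo) ((mu j)^-1)%:E)%E].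

Definition degree mu A a b : nat :=
  (2 * supremum 0%N
    [set k | (\sum_((start_index A b).+1 <= j < k.+1) (a * mu j)^-1 < expR 1)%R])%N.

End Degree.

Section Interpolation.
Context {R : realType}.
Implicit Types (h : R -> R) (mu : nat -> R).

Definition piecewise_C1 h : Prop :=
  forall T : R, 1 < T -> exists (l : nat) (t : nat -> R),
    [/\ t 0%N = 1, t l = T &
      forall i, (i < l)%N -> t i < t i.+1 /\
        exists p : R -> R, [/\ forall s, derivable p s 1, continuous (derive1 p) &
          forall s, t i <= s <= t i.+1 -> h s = p s]].

Definition interpolates mu h : Prop :=
  [/\ forall s t, 1 <= s -> s <= t -> h s <= h t,
      {within `[1, +oo[, continuous h},
      piecewise_C1 h,
      forall s, 1 <= s -> 0 < h s
    & forall j, (1 <= j)%N -> h j%:R = mu j].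

(* Derivative of a function on [1, +oo[: the left derivative (which is the
   derivative wherever there is one), except at the left end point of the
   domain, where only the right derivative makes sense. *)
Definition ldv h (s : R) : R :=
  lim ((fun u => u^-1 * (h (u + s) - h s)) @
       (if s == 1 then 0^'+ else 0^'-)).

Definition gamma h (k : nat) : R :=
  sup [set s * ldv h s / h s | s in `[1, k%:R]].

Definition C_const h (N : nat) : R := (4 * expR (4 + gamma h N)) ^+ N.

End Interpolation.

Section AdmissibleSets.
Context {R : realType} {n : nat}.
Local Notation V := 'rV[R]_n.

Definition poly_map := 'I_n -> mpoly.mpoly n R.

Definition poly_eval (P : poly_map) (x : V) : V :=
  \row_i mpoly.meval (fun j => x ord0 j) (P i).

Definition degree_le (d : nat) (P : poly_map) : Prop :=
  forall i, (mpoly.msize (P i) <= d.+1)%N.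

Definition jac (P : poly_map) : mpoly.mpoly n R :=
  \det (\matrix_(i < n, j < n) mpoly.mderiv j (P i)).

Definition coef_sum (p : mpoly.mpoly n R) : R :=
  \sum_(k <- mpoly.msupp p) `|mpoly.mcoeff k p|.

Definition orthant : set V := [set x | forall i, 0 <= x ord0 i].

Definition set_coord (i : 'I_n) (t : R) (x : V) : V :=
  \row_j (if j == i then t else x ord0 j).

Definition polynomial_in (i : 'I_n) (Y : V -> V) : Prop :=
  forall x, orthant x -> forall l, exists p : {poly R},
    forall t, 0 <= t -> Y (set_coord i t x) ord0 l = p.[t].

(* The values of Y w outside the orthant are irrelevant. *)
Definition admissible_collection (d : nat) (T : Type) (W : set T)
    (Kw : T -> set V) (aw : T -> V) (Y : T -> V -> V) : Prop :=
  [/\ (1 <= d)%N,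
      forall w, W w ->
        [/\ Kw w `<=` [set x | forall i, 0 <= x ord0 i <= 1],
            compact (Kw w) & Kw w (aw w)]
    & exists (delta1 delta2 delta3 : R) (q : nat) (P : T -> poly_map),
      [/\ 0 < delta1, 0 < delta2, 0 < delta3, (1 <= q)%N
        & forall w, W w ->
          degree_le d (P w) /\
          [/\ star_shaped (aw w) (Kw w) /\ delta1 <= vol (Kw w),
              forall x, orthant x ->
                Y w x = poly_eval (P w) (\row_i (x ord0 i `^ (q%:R)^-1)),
              delta2 <= coef_sum (jac (P w)) <= delta3
            & forall i, ~ polynomial_in i (Y w) -> aw w ord0 i = 0]]].

Definition admissible_set (d : nat) (K : set V) : Prop :=
  [/\ K !=set0, compact K
    & exists (Kw : V -> set V) (aw : V -> V) (Y : V -> V -> V),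
      [/\ admissible_collection d K Kw aw Y,
          forall w, K w -> Y w (aw w) = w
        & K = \bigcup_(w in K) (Y w @` Kw w)]].

Definition a_const (d : nat) (K : set V) : R :=
  if (2 <= d)%N then
    4 * ((d.+1 ^ d.+1)%N%:R / (d.-1 ^ d.-1)%N%:R) * Num.max (diam K) 1
  else diam K.

(* nu is a possible value of the exponent of the Remez inequality on K.
   tmu assigns to each weight its chosen interpolation, and d is the chosen
   degree of K. *)
Definition remez_exponent (tmu : (nat -> R) -> R -> R) (d : nat) (K : set V)
    (nu : R) : Prop :=
  [/\ 0 < nu <= 1,
      convex_body K -> nu = n%:R^-1
    & forall (L : set V) (mu : nat -> R) (M0 b0 : R) (m : nat)
        (f : V -> 'rV[R]_m) (E : set V),
      let N := degree mu (m%:R * M0) (a_const d K) b0 in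
      convex_body L -> K `<=` L ->
      admissible_weight mu -> (forall j, (1 <= j)%N -> j%:R <= mu j) ->
      0 < b0 -> b0 < M0 -> (1 <= m)%N ->
      admissible_tuple mu (m%:R * M0) (a_const d K) b0 ->
      smooth mu N M0 L f -> b0 <= norm_on f K ->
      lebesgue_measurable E -> E `<=` K -> 0 < vol E ->
      norm_on f K <=
        C_const (tmu mu) N *
        (m%:R * vol K `^ nu / (vol K `^ nu - (vol K - vol E) `^ nu)) ^+ N *
        norm_on f E].

End AdmissibleSets.

(* Main.v *)
(** Apply the Remez inequality to the part [E] of [K] in [B(x, |g x| / 2)].
    Thickness bounds [|E|] from below by [c (|g x| / 2)^theta], and concavity of
    [t^nu] gives [|K|^nu - (|K| - |E|)^nu >= nu |E| |K|^(nu - 1)], so the Remez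
    factor is at most [m |K| / (nu |E|)]. If [g x = 0], the left-hand side
    vanishes: [m M0 > b0] forces the degree to be positive. Euclidean balls are
    measurable because the coordinate half-spaces are: a hyperplane cuts each box
    of a cover into two boxes whose volumes add up. *)

Require Import Defs.
From HB Require Import structures.
From mathcomp Require Import all_boot all_order all_algebra.
From mathcomp Require Import all_classical all_reals all_analysis.
From mathcomp Require Import measurable_realfun.
From mathcomp Require Import ring lra.
Import Order.TTheory GRing.Theory Num.Theory.
Import numFieldNormedType.Exports.

Set Implicit Arguments.
Unset Strict Implicit.
Unset Printing Implicit Defensive.

Local Open Scope classical_set_scope.
Local Open Scope ring_scope.

(** * Lebesgue outer measure: subadditivity and half-spaces *)

Section LebesgueOuter.
Context {R : realType}.

Lemma box_vol_ge0 n (a b : 'rV[R]_n) :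
  (forall i, a ord0 i <= b ord0 i) -> 0 <= box_vol a b.
Proof. by move=> ab; apply: prodr_ge0 => i _; rewrite subr_ge0. Qed.

Lemma lebesgue_outer_ge0 n (A : set 'rV[R]_n) : (0 <= lebesgue_outer A)%E.
Proof.
apply/le_ereal_inf_tmp => _ [a [b [ab _ ->]]].
by apply: nneseries_ge0 => k _ _; rewrite lee_fin box_vol_ge0.
Qed.

Lemma lebesgue_outer_le_cover n (A : set 'rV[R]_n) (a b : nat -> 'rV[R]_n) :
  (forall k i, a k ord0 i <= b k ord0 i) ->
  A `<=` \bigcup_k box (a k) (b k) ->
  (lebesgue_outer A <= \sum_(0 <= k <oo) (box_vol (a k) (b k))%:E)%E.
Proof. by move=> ab AB; apply: ereal_inf_lbound; exists a, b. Qed.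

Lemma lebesgue_outer_le_box n (a b : 'rV[R]_n.+1) :
  (forall i, a ord0 i <= b ord0 i) ->
  (lebesgue_outer (box a b) <= (box_vol a b)%:E)%E.
Proof.
(* Covers are infinite sequences, so the box is padded with flat boxes [box a a], of volume 0
   because the dimension is positive. *)
move=> ab; pose b' k := if k is 0%N then b else a.
apply: le_trans (@lebesgue_outer_le_cover _ _ (fun=> a) b' _ _) _.
- by case=> [|k] i /=.
- by move=> x xab; exists 0%N.
- rewrite nneseries_recl//=; last first.
    by move=> [|k] _; rewrite lee_fin box_vol_ge0.
  rewrite eseries0 ?adde0// => -[//|k] _ _ /=.
  by rewrite /box_vol big_ord_recl subrr mul0r.
Qed.

(** Positive dimension matters: in dimension 0 the empty product gives every box volume 1, so every
    cover costs [+oo]. *)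
Lemma lebesgue_outer_set0 n : lebesgue_outer (@set0 'rV[R]_n.+1) = 0%E.
Proof.
apply/eqP; rewrite eq_le lebesgue_outer_ge0 andbT.
apply: le_trans (@lebesgue_outer_le_cover _ _ (fun=> 0) (fun=> 0) _ _) _ => //.
by rewrite eseries0// => k _ _; rewrite /box_vol big_ord_recl subrr mul0r.
Qed.

Lemma le_lebesgue_outer n (A B : set 'rV[R]_n) :
  A `<=` B -> (lebesgue_outer A <= lebesgue_outer B)%E.
Proof.
move=> AB; apply/le_ereal_inf_tmp => _ [a [b [ab Bab ->]]].
exact/lebesgue_outer_le_cover/(subset_trans AB).
Qed.

(** Both sides equal the unordered sum over all pairs, since the terms are nonnegative. This merges
    countably many covers into one. *)
Lemma nneseries_pair (u : nat -> nat -> \bar R)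
    (h : {bij [set: nat] >-> [set: nat * nat]}) :
  (forall i j, 0 <= u i j)%E ->
  (\sum_(0 <= k <oo) u (h k).1 (h k).2 =
   \sum_(0 <= i <oo) \sum_(0 <= j <oo) u i j)%E.
Proof.
move=> u0; rewrite nneseries_esumT// nneseries_esumT; last first.
  by move=> i; apply: nneseries_ge0 => j _ _; exact: u0.
under [RHS]eq_esum do rewrite nneseries_esumT//.
rewrite esum_esum// (_ : _ `*`` _ = setT); last by apply/seteqP; split.
by rewrite (reindex_esum setT setT h).
Qed.

Lemma lebesgue_outer_sigma_subadditive n :
  sigma_subadditive (@lebesgue_outer R n).
Proof.
(* One piece of infinite outer measure makes the right-hand side infinite. Otherwise near-optimal
   covers exist, and slacks [e / 2 ^ k.+1] add up to [e]. *)
move=> A; have [[i ioo]|] := pselect (exists i, lebesgue_outer (A i) = +oo)%E.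
  rewrite (eseries_pinfty _ _ ioo) ?leey// => k _.
  by rewrite -ltNye (lt_le_trans _ (lebesgue_outer_ge0 _)).
rewrite -forallNE => Aoo.
apply/lee_addgt0Pr => e e0.
apply: le_trans (epsilon_trick _ _ (ltW e0)); last first.
  by move=> k; exact: lebesgue_outer_ge0.
have /choice[ab abP] k : exists ab : (nat -> 'rV[R]_n) * (nat -> 'rV[R]_n),
    [/\ forall l i, ab.1 l ord0 i <= ab.2 l ord0 i,
        A k `<=` \bigcup_l box (ab.1 l) (ab.2 l)
      & (\sum_(0 <= l <oo) (box_vol (ab.1 l) (ab.2 l))%:E <=
         lebesgue_outer (A k) + (e / (2 ^ k.+1)%:R)%:E)%E].
  have Afin : lebesgue_outer (A k) \is a fin_num.
    by rewrite ge0_fin_numE ?lebesgue_outer_ge0// ltey; apply/eqP.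
  have ek : 0 < e / (2 ^ k.+1)%:R by rewrite divr_gt0// ltr0n expn_gt0.
  have [_ [a [b [ab Aab ->]]] le_e] := lb_ereal_inf_adherent ek Afin.
  by exists (a, b); split => //; exact: ltW.
have /card_esym/ppcard_eqP[h] := card_nat2.
pose v k l := (box_vol ((ab k).1 l) ((ab k).2 l))%:E.
have v0 k l : (0 <= v k l)%E.
  by rewrite lee_fin box_vol_ge0//; have [] := abP k.
apply: (@le_trans _ _ (\sum_(0 <= k <oo) \sum_(0 <= l <oo) v k l)%E); last first.
  apply: lee_nneseries => [k _ _|k _]; last by have [] := abP k.
  by apply: nneseries_ge0 => l _ _; exact: v0.
rewrite -(nneseries_pair h v0).
apply: lebesgue_outer_le_cover; first by move=> k; have [] := abP (h k).1.
move=> x [k _ /((let: And3 _ H _ := abP k in H) x)[l _ xkl]].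
by exists (h^-1%FUN (k, l)) => //=; rewrite invK ?inE.
Qed.

Lemma lebesgue_outer_halfspace n (i : 'I_n) (t : R) (X : set 'rV[R]_n) :
  (lebesgue_outer (X `&` [set x | (x ord0 i < t)%R]) +
   lebesgue_outer (X `&` ~` [set x | (x ord0 i < t)%R]) <= lebesgue_outer X)%E.
Proof.
apply/le_ereal_inf_tmp => _ [a [b [ab Xab ->]]].
(* [s k] is [t] clamped to the [i]-th side of the box: a box that the hyperplane misses splits into
   itself and a flat box. *)
pose s k := Num.max (a k ord0 i) (Num.min (b k ord0 i) t).
have as_ k : a k ord0 i <= s k by rewrite le_max lexx.
have sb k : s k <= b k ord0 i by rewrite ge_max ab ge_min lexx.
have -> : (\sum_(0 <= k <oo) (box_vol (a k) (b k))%:E =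
    \sum_(0 <= k <oo) (box_vol (a k) (set_coord i (s k) (b k)))%:E +
    \sum_(0 <= k <oo) (box_vol (set_coord i (s k) (a k)) (b k))%:E)%E.
  rewrite -nneseriesD; first last.
  - move=> k _ _; rewrite lee_fin box_vol_ge0// => j; rewrite mxE.
    by case: eqP => [->|].
  - move=> k _ _; rewrite lee_fin box_vol_ge0// => j; rewrite mxE.
    by case: eqP => [->|].
  apply: eq_eseriesr => k _; rewrite -EFinD /box_vol; congr EFin.
  rewrite (bigD1 i)//= [X in _ = X + _](bigD1 i)//= [X in _ = _ + X](bigD1 i)//=.
  rewrite !mxE eqxx.
  under [in X in _ = X + _]eq_bigr => j ji do rewrite mxE (negbTE ji).
  under [in X in _ = _ + X]eq_bigr => j ji do rewrite mxE (negbTE ji).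
  by ring.
apply: leeD; apply: lebesgue_outer_le_cover.
- by move=> k j; rewrite mxE; case: eqP => [->|].
- move=> x [/Xab[k _ /= xk] xt]; exists k => // j; rewrite mxE.
  have /andP[axj xbj] := xk j; rewrite axj/=.
  case: eqP => [ji|//]; rewrite ji in xbj *.
  by rewrite le_max le_min xbj (ltW xt) orbT.
- by move=> k j; rewrite mxE; case: eqP => [->|].
- move=> x [/Xab[k _ /= xk] /negP]; rewrite -leNgt => tx; exists k => // j.
  rewrite mxE; have /andP[axj xbj] := xk j; rewrite xbj andbT.
  case: eqP => [ji|//]; rewrite ji in axj *.
  by rewrite ge_max axj ge_min tx orbT.
Qed.

End LebesgueOuter.

(** * Positivity of the degree *)

(** As [ln (A / b) > 0], the start index [j0] is at least 1, and it lies in [S] because its sum is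
    empty. Admissibility bounds [S], so [supremum] does not fall back on its default 0. *)
Lemma degree_gt0 (R : realType) (mu : nat -> R) (A a b : R) :
  (forall j, (1 <= j)%N -> 0 < mu j) -> b < A -> admissible_tuple mu A a b ->
  (0 < degree mu A a b)%N.
Proof.
move=> mu0 bA [A0 a0 b0 adm]; rewrite /degree.
set S := [set k | _]; set j0 := start_index A b in adm S *.
have j00 : (0 < j0)%N.
  rewrite /j0 /start_index absz_gt0 gt_eqF// lt_max ltxx /=.
  by rewrite ceil_gt0 ln_gt0// ltr_pdivlMr// mul1r.
have Sj0 : S j0 by rewrite /S/= big_geq// expR_gt0.
suff : supremums S !=set0.
  move=> /ge_supremum_Nmem - /(_ 0%N _ Sj0) j0S.
  by rewrite muln_gt0/=; exact: leq_trans j00 j0S.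
apply: nat_supremums_neq0; apply: contrapT => noub.
move: adm; apply/negP; rewrite -leNgt.
apply: lime_le.
  apply: is_cvg_nneseries => k jk _.
  by rewrite lee_fin invr_ge0 ltW// mu0// (leq_trans _ jk).
apply: nearW => k.
(* If [S] were unbounded, each partial sum of the [(mu j)^-1] would be dominated by one ending at a
   member of [S], hence by [a * expR 1], against admissibility. *)
have [k' [Sk' kk']] : exists k', S k' /\ (k <= k')%N.
  apply: contrapT => /forallNP h; apply: noub; exists k => k' Sk'.
  by have /not_andP[//|/negP] := h k'; rewrite -ltnNge => /ltnW.
rewrite sumEFin lee_fin; apply: (@le_trans _ _ (\sum_(j0.+1 <= j < k'.+1) (mu j)^-1)).
  have [kj|jk] := leqP k j0.+1.
    rewrite big_geq//; rewrite big_nat; apply: sumr_ge0 => j /andP[jj _].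
    by rewrite invr_ge0 ltW// mu0// (leq_trans _ jj).
  rewrite (@big_cat_nat _ _ _ k _ k'.+1)//= ?(ltnW jk)// ?(leq_trans kk')//.
  rewrite lerDl big_nat; apply: sumr_ge0 => j /andP[kj _].
  by rewrite invr_ge0 ltW// mu0// (leq_trans _ kj)// (leq_trans _ jk).
rewrite mulrC -ler_pdivrMr//.
apply: ltW; move: Sk'; rewrite /S/=.
by under eq_bigr do rewrite invfM mulrC; rewrite -mulr_suml.
Qed.

(** * Measurability of balls and finiteness on compact sets *)

(** Gives access to the sigma-algebra of Caratheodory measurable sets. *)
HB.instance Definition _ (R : realType) (n : nat) :=
  isOuterMeasure.Build R 'rV[R]_n.+1 (@lebesgue_outer R n.+1)
    (@lebesgue_outer_set0 R n) (@lebesgue_outer_ge0 R n.+1)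
    (@le_lebesgue_outer R n.+1) (@lebesgue_outer_sigma_subadditive R n.+1).

Lemma lebesgue_measurable_eball (R : realType) (n : nat) (x : 'rV[R]_n.+1) r :
  lebesgue_measurable (eball x r).
Proof.
pose T := caratheodory_type (@lebesgue_outer R n.+1).
have coordm (i : 'I_n.+1) : measurable_fun [set: T] (fun y : T => y ord0 i).
  (* Open left rays generate the Borel sets, and their preimages under a coordinate are
     half-spaces. *)
  move=> mT; apply: (measurability _ (RGenInftyO.measurableE R)) => //.
  move=> /= _ [_ [t ->] <-]; rewrite setTI.
  apply: le_caratheodory_measurable => X.
  rewrite (_ : _ @^-1` _ = [set y : 'rV[R]_n.+1 | (y ord0 i < t)%R]).
    exact: lebesgue_outer_halfspace.
  by apply/seteqP; split => y /=; rewrite in_itv.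
have dist_meas : measurable_fun [set: T] (fun y : T => enorm (y - x)).
  apply: measurableT_comp => //.
    by apply: continuous_measurable_fun; exact: sqrt_continuous.
  apply: measurable_sum => i; apply: measurable_funX.
  rewrite [X in measurable_fun _ X](_ : _ = (fun y : T => y ord0 i - x ord0 i)).
    exact: measurable_funB.
  by apply/funext => y; rewrite !mxE.
have -> : eball x r = [set: T] `&` (fun y : T => enorm (y - x)) @^-1` `]-oo, r].
  by apply/seteqP; split => [y yr|y [_]] /=; rewrite in_itv.
exact: dist_meas.
Qed.

Lemma compact_lebesgue_outer_fin_num (R : realType) (n : nat)
    (K : set 'rV[R]_n.+1) :
  compact K -> lebesgue_outer K \is a fin_num.
Proof.
move=> /compact_bounded[M [_ KM]].
(* Boundedness provides a bound by every number above [M], and [M] may be negative; hence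
   [|M| + 1]. *)
pose u : 'rV[R]_n.+1 := \row_i (`|M| + 1).
have M0 : 0 <= `|M| + 1 by rewrite addr_ge0.
rewrite ge0_fin_numE ?lebesgue_outer_ge0//.
have Ku : K `<=` box (- u) u.
  move=> x Kx i; rewrite !mxE -ler_norml.
  have : `|x| <= `|M| + 1.
    by apply: (KM (`|M| + 1)) => //; rewrite (le_lt_trans (ler_norm _))// ltrDl.
  apply: le_trans; rewrite [leRHS]mx_normrE.
  exact: (le_bigmax _ (fun ij => `|x ij.1 ij.2|) (ord0, i)).
apply: le_lt_trans (le_lebesgue_outer Ku) _.
apply: le_lt_trans (lebesgue_outer_le_box _) (ltry _) => i.
by rewrite !mxE ge0_cp.
Qed.

(** * Norms and real powers *)

Lemma norm_on_ge0 (R : realType) (n m : nat) (f : 'rV[R]_n -> 'rV[R]_m) E :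
  0 <= norm_on f E.
Proof.
rewrite /norm_on; set S := [set _ | _ in _].
(* [sup] is 0 on an empty set and on one unbounded above. *)
have [Ssup|nS] := pselect (has_sup S); last by rewrite sup_out.
have [[y [x Ex yE]] Sub] := Ssup.
apply: le_trans (ub_le_sup Sub _); last by exists x.
exact: sumr_ge0.
Qed.

(* Convexity of the exponential, from its tangent at [p ln s]. *)
Lemma powR_le_tangent (R : realType) (s p : R) :
  0 <= s -> 0 < p <= 1 -> s `^ p <= 1 + p * (s - 1).
Proof.
move=> + /andP[p0 p1]; rewrite le_eqVlt => /predU1P[<-|s0].
  by rewrite powR0 ?gt_eqF//; lra.
pose y := p * ln s; have e0 := expR_gt0 y.
have tan0 : expR y * (1 - y) <= 1.
  by rewrite -[leRHS](expRxMexpNx_1 y) ler_pM2l// expR_ge1Dx.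
have tans : expR y * (1 + (ln s - y)) <= s.
  rewrite -[leRHS](lnK s0) -[in leRHS](subrKC y (ln s)) expRD.
  by rewrite ler_pM2l// expR_ge1Dx.
have -> : s `^ p = expR y by rewrite /powR gt_eqF.
(* The tangent bounds at 0 and at [ln s], weighted by [1 - p] and [p]: the linear terms cancel
   because [y = p * ln s]. *)
have h0 : (1 - p) * (expR y * (1 - y)) <= (1 - p) * 1.
  by apply: ler_wpM2l => //; rewrite subr_ge0.
have h1 : p * (expR y * (1 + (ln s - y))) <= p * s.
  by apply: ler_wpM2l => //; exact: ltW.
rewrite {}/y in e0 tan0 tans h0 h1 *; lra.
Qed.

(** By homogeneity this is the tangent bound at [1 - v / V]. The factor [V] to the power [p] is kept
    so as to cancel the numerator of the Remez factor. *)
Lemma powR_sub_ge (R : realType) (V v p : R) :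
  0 < V -> 0 <= v <= V -> 0 < p <= 1 ->
  p * v / V * V `^ p <= V `^ p - (V - v) `^ p.
Proof.
move=> V0 /andP[v0 vV] p01.
have s0 : 0 <= 1 - v / V by rewrite subr_ge0 ler_pdivrMr// mul1r.
have -> : V - v = V * (1 - v / V) by rewrite mulrBr mulr1 mulrC divfK ?gt_eqF.
rewrite powRM ?(ltW V0)//.
have := ler_wpM2l (powR_ge0 V p) (powR_le_tangent s0 p01).
lra.
Qed.

Lemma C_const_gt0 (R : realType) (h : R -> R) N : 0 < C_const h N.
Proof. by rewrite exprn_gt0// mulr_gt0// expR_gt0. Qed.

(** * The lower bound on small balls *)

Theorem theorem8p3 (R : realType) (n : nat) (n_gt0 : (0 < n)%N)
  (* the fixed choice of an interpolation of every admissible weight *)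
  (tmu : (nat -> R) -> R -> R)
  (tmuP : forall mu, admissible_weight mu -> interpolates mu (tmu mu))
  (L K : set 'rV[R]_n) (L_convex : convex_body L) (KL : K `<=` L)
  (* the fixed degree of K *)
  (d : nat) (K_adm : admissible_set d K) (d_convex : convex_body K -> d = 1%N)
  (nu : R) (nuP : remez_exponent tmu d K nu)
  (c theta : R) (K_thick : thick c theta K)
  (mu : nat -> R) (mu_adm : admissible_weight mu)
  (mu_ge : forall j, (1 <= j)%N -> j%:R <= mu j)
  (M0 b0 : R) (b0_gt0 : 0 < b0) (b0_lt_M0 : b0 < M0)
  (m : nat) (m_gt0 : (1 <= m)%N)
  (tuple_adm : admissible_tuple mu (m%:R * M0) (a_const d K) b0)
  (f : 'rV[R]_n -> 'rV[R]_m)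
  (f_smooth : smooth mu (degree mu (m%:R * M0) (a_const d K) b0) M0 L f)
  (f_ge : b0 <= norm_on f K)
  (g : 'rV[R]_n -> R) (g_itv : forall x, K x -> -1 <= g x <= 1) :
  let N := degree mu (m%:R * M0) (a_const d K) b0 in
  forall x, K x ->
    norm_on f K / C_const (tmu mu) N *
      (c * nu / (m%:R * 2 `^ theta * vol K)) ^+ N * `|g x| `^ (theta * N%:R)
    <= norm_on f (eball x (`|g x| / 2) `&` K).
Proof.
case: n n_gt0 => [//|n] _ in L K L_convex KL K_adm d_convex nuP K_thick
  tuple_adm f f_smooth f_ge g g_itv *.
move=> N x Kx; set r := `|g x| / 2; set E := eball x r `&` K.
have [nu01 _ remez] := nuP; have [nu0 nu1] := andP nu01.
have [_ Kmeas c0 theta0 K_thin] := K_thick.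
have [_ Kcomp _] := K_adm.
have m0 : 0 < m%:R :> R by rewrite ltr0n.
have N0 : (0 < N)%N.
  apply: degree_gt0 tuple_adm => [j j1|].
    by rewrite (lt_le_trans _ (mu_ge _ j1))// ltr0n.
  by rewrite (lt_le_trans b0_lt_M0)// ler_peMl ?ler1n// (ltW (lt_trans b0_gt0 _)).
have [gx0|gx_neq0] := eqVneq (g x) 0.
  (* A real power of 0 vanishes only for a nonzero exponent, hence the use of [N0]. *)
  by rewrite gx0 normr0 powR0 ?mulr0 ?norm_on_ge0// mulf_neq0 ?gt_eqF ?ltr0n.
have gx_gt0 : 0 < `|g x| by rewrite normr_gt0.
have r01 : 0 < r <= 1.
  rewrite divr_gt0//= ler_pdivrMr// mul1r.
  by rewrite (@le_trans _ _ 1) ?ler1n// ler_norml; exact: g_itv.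
(* [vol] sends infinite measure to 0, so finiteness is needed to compare volumes as reals. *)
have Kfin := compact_lebesgue_outer_fin_num Kcomp.
have EK : E `<=` K by move=> y [].
have EleK : (lebesgue_outer E <= lebesgue_outer K)%E := le_lebesgue_outer EK.
have Efin : lebesgue_outer E \is a fin_num.
  rewrite ge0_fin_numE ?lebesgue_outer_ge0//.
  by rewrite (le_lt_trans EleK)// -ge0_fin_numE ?lebesgue_outer_ge0.
have vE_ge : c * r `^ theta <= vol E.
  by rewrite -lee_fin fineK// /E setIC; exact: K_thin.
have vE_le : vol E <= vol K by rewrite fine_le.
have cr0 : 0 < c * r `^ theta by rewrite mulr_gt0 ?powR_gt0//; case/andP: r01.
have vE0 : 0 < vol E := lt_le_trans cr0 vE_ge.
have vK0 : 0 < vol K := lt_le_trans vE0 vE_le.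
have Emeas : lebesgue_measurable E.
  apply: caratheodory_measurable_setI => //.
  exact: lebesgue_measurable_eball.
have := remez L mu M0 b0 m f E L_convex KL mu_adm mu_ge b0_gt0 b0_lt_M0 m_gt0
  tuple_adm f_smooth f_ge Emeas EK vE0.
rewrite -/N; set C := C_const _ _; set s := _ / _.
have C0 : 0 < C by exact: C_const_gt0.
set q := c * nu / (m%:R * 2 `^ theta * vol K) => remezE.
have V0 : 0 < vol K `^ nu by rewrite powR_gt0.
have q0 : 0 < q by rewrite divr_gt0 ?mulr_gt0 ?powR_gt0.
(* The thickness bound on [vol E], inserted in the Remez factor [s]. *)
have s_le : q * `|g x| `^ theta * s <= 1.
  have vEK : 0 <= vol E <= vol K by rewrite (ltW vE0).
  have sub_ge := powR_sub_ge vK0 vEK nu01.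
  have D0 : 0 < vol K `^ nu - (vol K - vol E) `^ nu.
    by rewrite (lt_le_trans _ sub_ge)// !mulr_gt0 ?invr_gt0.
  rewrite /s mulrA ler_pdivrMr// mul1r; apply: le_trans sub_ge.
  rewrite mulrA; apply: ler_wpM2r; first exact: ltW.
  (* Halving [|g x|] in the radius produces exactly the factor [2] to the power [theta] in the
     denominator of [q]. *)
  have -> : q * `|g x| `^ theta * m%:R = nu / vol K * (c * r `^ theta).
    rewrite /r powRM ?invr_ge0// -(powR_inv1 (ler0n R 2)) powRAC powR_inv1 ?powR_ge0//.
    rewrite /q; field.
    by rewrite !gt_eqF ?powR_gt0.
  rewrite [nu * _ / _]mulrAC; apply: ler_wpM2l => //.
  by rewrite divr_ge0 ?ltW.
have s0 : 0 <= s.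
  rewrite /s divr_ge0 ?mulr_ge0 ?(ltW V0)// subr_ge0.
  apply: ge0_ler_powR; rewrite ?nnegrE ?(ltW nu0) ?subr_ge0 ?(ltW vK0)//.
  by rewrite gerBl ltW.
rewrite powRrM powR_mulrn ?powR_ge0// -mulrA -exprMn.
set w := q * _ in s_le *.
have w0 : 0 < w by rewrite mulr_gt0 ?powR_gt0.
rewrite mulrAC ler_pdivrMr//.
(* The Remez bound times [w ^+ N] reduces the goal to [(w * s) ^+ N <= 1], which follows from
   [s_le]. *)
apply: (le_trans (ler_wpM2r _ remezE)); first by rewrite exprn_ge0 ?ltW.
rewrite -mulrA mulrCA [leRHS]mulrC.
have h : (w * s) ^+ N <= 1 by rewrite exprn_ile1// mulr_ge0// ltW.
have := ler_wpM2l (mulr_ge0 (ltW C0) (norm_on_ge0 f E)) h.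
rewrite exprMn mulr1; apply: le_trans; rewrite le_eqVlt; apply/orP; left.
by apply/eqP; move: (C) (w ^+ N) (s ^+ N) (norm_on f E) => *; ring.
Qed.
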